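(* Let $0\le q\le1$ be real and $\phi$ an arbitrary phase, and assume that $qe^{-4i\phi}$ is not a root of unity (i.e. $(qe^{-4i\phi})^r\ne1$ for every positive integer $r$). Then any finite-dimensional irreducible representation $T$ of the algebra $\mathcal U_{q,\phi}(\hat u(2))$ is equivalent to one of the representations $T_{l,\psi}$ with $l\in\frac12\mathbb N$ (including $l=0$) and $\psi\in[0,2\pi)$, where $T_{l,\psi}$ acts on the $(2l+1)$-dimensional complex vector space $V_l$ with basis $\boldsymbol e_m$, $m=-l,-l+1,\dots,l$, by $$T_{l,\psi}(k)\boldsymbol e_m=q^me^{-4im\phi-i\psi}\boldsymbol e_m,\qquad T_{l,\psi}(k^* )\boldsymbol e_m=q^me^{4im\phi+i\psi}\boldsymbol e_m,$$ $$T_{l,\psi}(f)\boldsymbol e_m=\pm\sqrt{[l-m]_q[l+m+1]_q}\,\boldsymbol e_{m+1},\qquad T_{l,\psi}(e)\boldsymbol e_m=\pm\sqrt{[l+m]_q[l-m+1]_q}\,\boldsymbol e_{m-1},$$ the signs in the actions of $f$ and $e$ being the same.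
   Context: $[m]_q=\frac{q^m-q^{-m}}{q-q^{-1}}$ for $m\in\mathbb Z$. As an algebra, $\mathcal U_{q,\phi}(\hat u(2))$ is the unital complex $*$-algebra generated by $e$, $f=e^*$ and invertible elements $k$, $k^*$, subject to $ek=qe^{-4i\phi}ke$, $kf=qe^{-4i\phi}fk$, $k^*f=qe^{4i\phi}fk^*$, $ek^*=qe^{4i\phi}k^*e$, $kk^*=k^*k$, $ef-fe=\frac1{q^{-1}-q}\left(kk^*-k^{-1}(k^* )^{-1}\right)$.
   Formalization: ''Representation'' is taken as *-representation on a finite-dimensional inner product space (otherwise e=f=0, k=2, k*=1/2 in dimension 1 is a counterexample), and q=0 and q=1 are excluded because there the relation for ef-fe and [m]_q are undefined. *)

(* Defs.v *)
From HB Require Import structures.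
From mathcomp Require Import all_boot all_order all_algebra.
From mathcomp Require Import generic_quotient sesquilinear.
From mathcomp Require Import complex.
From mathcomp Require Import all_classical all_reals all_analysis.

Set Implicit Arguments.
Unset Strict Implicit.
Unset Printing Implicit Defensive.

Import Order.TTheory GRing.Theory Num.Theory Num.Def.

Local Open Scope ring_scope.
Local Open Scope complex_scope.
Local Open Scope quotient_scope.

Section Scalars.
Variable R : realType.

Definition expi (t : R) : R[i] := (cos t) +i* (sin t).

Definition qint (q : R) (m : int) : R := (q ^ m - q ^ (- m)) / (q - q^-1).

End Scalars.

(* Expressions in e, k, k^{-1} and their stars; f and the inverse of k^* are
   the stars of e and k^{-1}. *)
Inductive uterm (R : realType) : Type :=
  | uC of R[i]
  | uE
  | uK
  | uKinv
  | uAdd of uterm R & uterm R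
  | uMul of uterm R & uterm R
  | uStar of uterm R.

Arguments uE {R}.
Arguments uK {R}.
Arguments uKinv {R}.

HB.instance Definition _ (R : realType) := gen_eqMixin (uterm R).
HB.instance Definition _ (R : realType) := gen_choiceMixin (uterm R).

Declare Scope uterm_scope.
Delimit Scope uterm_scope with U.
Bind Scope uterm_scope with uterm.
Local Notation "s + t" := (uAdd s t) : uterm_scope.
Local Notation "s * t" := (uMul s t) : uterm_scope.
Local Notation "s - t" := (uAdd s (uMul (uC (- 1)) t)) : uterm_scope.
Local Notation uF := (uStar uE).
Local Notation uKs := (uStar uK).
Local Notation uKsinv := (uStar uKinv).

(* the least *-algebra congruence containing the defining relations *)
Inductive ucong (R : realType) (q phi : R) : uterm R -> uterm R -> Prop :=
  | ucong_refl s : ucong q phi s s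
  | ucong_sym s t : ucong q phi s t -> ucong q phi t s
  | ucong_trans s t u : ucong q phi s t -> ucong q phi t u -> ucong q phi s u
  | ucong_add s s' t t' :
      ucong q phi s s' -> ucong q phi t t' -> ucong q phi (s + t) (s' + t')
  | ucong_mul s s' t t' :
      ucong q phi s s' -> ucong q phi t t' -> ucong q phi (s * t) (s' * t')
  | ucong_star s s' : ucong q phi s s' -> ucong q phi (uStar s) (uStar s')
  | ucong_addA s t u : ucong q phi (s + (t + u)) ((s + t) + u)
  | ucong_addC s t : ucong q phi (s + t) (t + s)
  | ucong_add0 s : ucong q phi (uC 0 + s) s
  | ucong_mulA s t u : ucong q phi (s * (t * u)) ((s * t) * u)
  | ucong_mul1 s : ucong q phi (uC 1 * s) s
  | ucong_mul0 s : ucong q phi (uC 0 * s) (uC 0)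
  | ucong_mulDl s t u : ucong q phi ((s + t) * u) (s * u + t * u)
  | ucong_mulDr s t u : ucong q phi (s * (t + u)) (s * t + s * u)
  | ucong_CD c d : ucong q phi (uC (c + d)) (uC c + uC d)
  | ucong_CM c d : ucong q phi (uC (c * d)) (uC c * uC d)
  | ucong_Ccomm c s : ucong q phi (uC c * s) (s * uC c)
  | ucong_starK s : ucong q phi (uStar (uStar s)) s
  | ucong_starD s t : ucong q phi (uStar (s + t)) (uStar s + uStar t)
  | ucong_starM s t : ucong q phi (uStar (s * t)) (uStar t * uStar s)
  | ucong_starC c : ucong q phi (uStar (uC c)) (uC (c^*)%R)
  | ucong_KV : ucong q phi (uK * uKinv) (uC 1)
  | ucong_VK : ucong q phi (uKinv * uK) (uC 1)
  | ucong_EK :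
      ucong q phi (uE * uK) (uC (q%:C * expi (- (4 * phi)))%R * (uK * uE))
  | ucong_KF :
      ucong q phi (uK * uF) (uC (q%:C * expi (- (4 * phi)))%R * (uF * uK))
  | ucong_KsF :
      ucong q phi (uKs * uF) (uC (q%:C * expi (4 * phi))%R * (uF * uKs))
  | ucong_EKs :
      ucong q phi (uE * uKs) (uC (q%:C * expi (4 * phi))%R * (uKs * uE))
  | ucong_KKs : ucong q phi (uK * uKs) (uKs * uK)
  | ucong_EF :
      ucong q phi (uE * uF - uF * uE)
        (uC ((q^-1 - q)^-1)%:C * (uK * uKs - uKinv * uKsinv)).

Arguments ucong {R} q phi _%_U _%_U.

Section Algebra.
Variables (R : realType) (q phi : R).

Definition ucongb : rel (uterm R) := fun s t => `[< ucong q phi s t >].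

Fact ucongb_refl : reflexive ucongb.
Proof. by move=> s; apply/asboolP; exact: ucong_refl. Qed.

Fact ucongb_sym : symmetric ucongb.
Proof. by move=> s t; apply/asboolP/asboolP; exact: ucong_sym. Qed.

Fact ucongb_trans : transitive ucongb.
Proof.
move=> t s u /asboolP st /asboolP tu; apply/asboolP; exact: ucong_trans st tu.
Qed.

Canonical ucongb_equiv := EquivRel ucongb ucongb_refl ucongb_sym ucongb_trans.

Definition Uqphi := {eq_quot ucongb_equiv}.
HB.instance Definition _ := Choice.on Uqphi.
HB.instance Definition _ := EqQuotient.on Uqphi.

Definition Upi (s : uterm R) : Uqphi := \pi_Uqphi s.

Lemma UpiP s t : Upi s = Upi t <-> ucong q phi s t.
Proof.
split=> [/eqP|st]; first by rewrite piE => /asboolP.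
by apply/eqP; rewrite piE; apply/asboolP.
Qed.

Lemma UreprP s : ucong q phi (repr (Upi s)) s.
Proof. by apply/UpiP; rewrite /Upi reprK. Qed.

Definition Uadd (x y : Uqphi) : Uqphi := Upi (repr x + repr y)%U.
Definition Umul (x y : Uqphi) : Uqphi := Upi (repr x * repr y)%U.
Definition Ustar (x : Uqphi) : Uqphi := Upi (uStar (repr x)).
Definition Uopp (x : Uqphi) : Uqphi := Upi (uC (-1) * repr x)%U.
Definition Uscale (c : R[i]) (x : Uqphi) : Uqphi := Upi (uC c * repr x)%U.

Definition Ugen_e : Uqphi := Upi uE.
Definition Ugen_k : Uqphi := Upi uK.

Lemma UaddE s t : Uadd (Upi s) (Upi t) = Upi (s + t)%U.
Proof. by apply/UpiP/ucong_add; exact: UreprP. Qed.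

Lemma UmulE s t : Umul (Upi s) (Upi t) = Upi (s * t)%U.
Proof. by apply/UpiP/ucong_mul; exact: UreprP. Qed.

Lemma UstarE s : Ustar (Upi s) = Upi (uStar s).
Proof. by apply/UpiP/ucong_star; exact: UreprP. Qed.

Lemma UoppE s : Uopp (Upi s) = Upi (uC (-1) * s)%U.
Proof. by apply/UpiP/ucong_mul; [exact: ucong_refl|exact: UreprP]. Qed.

Lemma UscaleE c s : Uscale c (Upi s) = Upi (uC c * s)%U.
Proof. by apply/UpiP/ucong_mul; [exact: ucong_refl|exact: UreprP]. Qed.

Lemma UpiW (P : Uqphi -> Prop) : (forall s, P (Upi s)) -> forall x, P x.
Proof. by move=> PU x; rewrite -[x]reprK; exact: PU. Qed.

Let UE := (UaddE, UmulE, UoppE, UscaleE, UstarE).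

Fact UaddA : associative Uadd.
Proof.
elim/UpiW=> s; elim/UpiW=> t; elim/UpiW=> u; rewrite !UE.
by apply/UpiP; exact: ucong_addA.
Qed.

Fact UaddC : commutative Uadd.
Proof.
by elim/UpiW=> s; elim/UpiW=> t; rewrite !UE; apply/UpiP; exact: ucong_addC.
Qed.

Fact Uadd0 : left_id (Upi (uC 0)) Uadd.
Proof. by elim/UpiW=> s; rewrite !UE; apply/UpiP; exact: ucong_add0. Qed.

Fact UmulDl : left_distributive Umul Uadd.
Proof.
elim/UpiW=> s; elim/UpiW=> t; elim/UpiW=> u; rewrite !UE.
by apply/UpiP; exact: ucong_mulDl.
Qed.

Fact UmulDr : right_distributive Umul Uadd.
Proof.
elim/UpiW=> s; elim/UpiW=> t; elim/UpiW=> u; rewrite !UE.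
by apply/UpiP; exact: ucong_mulDr.
Qed.

Fact Umul1 : left_id (Upi (uC 1)) Umul.
Proof. by elim/UpiW=> s; rewrite !UE; apply/UpiP; exact: ucong_mul1. Qed.

Fact Umul1r : right_id (Upi (uC 1)) Umul.
Proof.
elim/UpiW=> s; rewrite !UE; apply/UpiP.
exact: ucong_trans (ucong_sym (ucong_Ccomm _ _ _ _)) (ucong_mul1 _ _ _).
Qed.

Fact UmulA : associative Umul.
Proof.
elim/UpiW=> s; elim/UpiW=> t; elim/UpiW=> u; rewrite !UE.
by apply/UpiP; exact: ucong_mulA.
Qed.

Lemma UscaleM c x : Uscale c x = Umul (Upi (uC c)) x.
Proof. by elim/UpiW: x => s; rewrite !UE. Qed.

Lemma UCD c d : Upi (uC (c + d)) = Uadd (Upi (uC c)) (Upi (uC d)).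
Proof. by rewrite UE; apply/UpiP; exact: ucong_CD. Qed.

Lemma UCM c d : Upi (uC (c * d)) = Umul (Upi (uC c)) (Upi (uC d)).
Proof. by rewrite UE; apply/UpiP; exact: ucong_CM. Qed.

Lemma Umul0 x : Umul (Upi (uC 0)) x = Upi (uC 0).
Proof. by elim/UpiW: x => s; rewrite UE; apply/UpiP; exact: ucong_mul0. Qed.

Lemma UCcomm c x : Umul (Upi (uC c)) x = Umul x (Upi (uC c)).
Proof. by elim/UpiW: x => s; rewrite !UE; apply/UpiP; exact: ucong_Ccomm. Qed.

Fact UaddN : left_inverse (Upi (uC 0)) Uopp Uadd.
Proof.
move=> x; have -> : Uopp x = Uscale (- 1) x by [].
by rewrite UscaleM -{2}[x]Umul1 -UmulDl -UCD addNr Umul0.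
Qed.

(* the character e |-> 0, k |-> 1, separating 0 from 1 *)
Fixpoint ueval1 (s : uterm R) : R[i] :=
  match s with
  | uC c => c
  | uE => 0
  | uK | uKinv => 1
  | uAdd s t => ueval1 s + ueval1 t
  | uMul s t => ueval1 s * ueval1 t
  | uStar s => ((ueval1 s)^*)%R
  end.

Lemma ueval1_cong s t : ucong q phi s t -> ueval1 s = ueval1 t.
Proof.
elim=> //=; do ?[by move=> *; congruence].
- by move=> *; rewrite addrA.
- by move=> *; rewrite addrC.
- by move=> *; rewrite add0r.
- by move=> *; rewrite mulrA.
- by move=> *; rewrite mul1r.
- by move=> *; rewrite mul0r.
- by move=> *; rewrite mulrDl.
- by move=> *; rewrite mulrDr.
- by move=> *; rewrite mulrC.
- by move=> *; rewrite conjCK.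
- by move=> *; rewrite rmorphD.
- by move=> *; rewrite rmorphM mulrC.
all: by rewrite ?conjC0 ?conjC1 ?(mulr0, mul0r, mulr1, subrr, addr0).
Qed.

Fact U1_neq0 : Upi (uC 1) != Upi (uC 0).
Proof.
by apply/eqP=> /UpiP/ueval1_cong /= /eqP; rewrite oner_eq0.
Qed.

HB.instance Definition _ :=
  GRing.isZmodule.Build Uqphi UaddA UaddC Uadd0 UaddN.
HB.instance Definition _ :=
  GRing.Zmodule_isNzRing.Build Uqphi UmulA Umul1 Umul1r UmulDl UmulDr U1_neq0.

Fact UscaleA c d x : Uscale c (Uscale d x) = Uscale (c * d) x.
Proof. by rewrite !UscaleM UmulA UCM. Qed.

Fact Uscale1 : left_id 1 Uscale.
Proof. by move=> x; rewrite UscaleM Umul1. Qed.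

Fact UscaleDr : right_distributive Uscale Uadd.
Proof. by move=> c x y; rewrite !UscaleM UmulDr. Qed.

Fact UscaleDl x : {morph Uscale^~ x : c d / c + d >-> Uadd c d}.
Proof. by move=> c d /=; rewrite !UscaleM UCD UmulDl. Qed.

HB.instance Definition _ :=
  GRing.Zmodule_isLmodule.Build R[i] Uqphi UscaleA Uscale1 UscaleDr UscaleDl.

Fact UscaleAl c (x y : Uqphi) : c *: (x * y) = (c *: x) * y.
Proof.
by change (Uscale c (Umul x y) = Umul (Uscale c x) y); rewrite !UscaleM UmulA.
Qed.

Fact UscaleAr c (x y : Uqphi) : c *: (x * y) = x * (c *: y).
Proof.
change (Uscale c (Umul x y) = Umul x (Uscale c y)).
by rewrite !UscaleM UmulA UCcomm -!UmulA.
Qed.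

HB.instance Definition _ :=
  GRing.Lmodule_isLalgebra.Build R[i] Uqphi UscaleAl.
HB.instance Definition _ :=
  GRing.Lalgebra_isAlgebra.Build R[i] Uqphi UscaleAr.

End Algebra.

Section Representations.
Variables (R : realType) (q phi : R) (V : vectType R[i]).
Implicit Type T : {linear Uqphi q phi -> 'End(V)}.

Definition is_rep T : Prop :=
  T 1 = \1%VF /\ forall x y, T (x * y) = (T x \o T y)%VF.

Definition is_star_rep (dot : {dot V for conjC}) T : Prop :=
  is_rep T /\ forall x u v, dot (T x u) v = dot u (T (Ustar x) v).

Definition irreducible_rep T : Prop :=
  {:V}%VS != 0%VS /\
  forall W : {vspace V}, (forall x, (T x @: W <= W)%VS) ->
    W = 0%VS \/ W = {:V}%VS.

End Representations.

Definition equivalent_rep (R : realType) (q phi : R) (V W : vectType R[i])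
    (T : {linear Uqphi q phi -> 'End(V)})
    (T' : {linear Uqphi q phi -> 'End(W)}) : Prop :=
  exists S : 'Hom(V, W), bijective S /\ forall x v, S (T x v) = T' x (S v).

Section Tlpsi.
Variables (R : realType) (q phi psi : R) (n : nat).

(* The spin is l = n / 2; the weight m = - l + j is indexed by j = 0, ..., n,
   so that l - m = n - j and l + m = j *)
Definition weight (j : nat) : R := j%:R - n%:R / 2.

(* e_m, with the convention e_m = 0 when j > n *)
Definition wvec (j : nat) : 'cV[R[i]]_n.+1 := \col_i (i == j :> nat)%:R.

(* the choice of sign is (-1)^b; for j = 0 the coefficient of wvec j.-1 is 0 *)
Definition is_Tlpsi (b : bool)
    (T : {linear Uqphi q phi -> 'End('cV[R[i]]_n.+1)}) : Prop :=
  forall j : nat, (j <= n)%N ->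
  let m := weight j in
  [/\ T (Ugen_k q phi) (wvec j)
        = ((q `^ m)%:C * expi (- (4 * m * phi) - psi)) *: wvec j,
      T (Ustar (Ugen_k q phi)) (wvec j)
        = ((q `^ m)%:C * expi (4 * m * phi + psi)) *: wvec j,
      T (Ustar (Ugen_e q phi)) (wvec j)
        = ((-1) ^+ b * Num.sqrt (qint q (n%:Z - j%:Z) * qint q (j%:Z + 1)))%:C
          *: wvec j.+1 &
      T (Ugen_e q phi) (wvec j)
        = ((-1) ^+ b * Num.sqrt (qint q j%:Z * qint q (n%:Z - j%:Z + 1)))%:C
          *: wvec j.-1].

End Tlpsi.

(* Main.v *)
From HB Require Import structures.
Require Import Defs.
From mathcomp Require Import all_boot all_order all_algebra.
From mathcomp Require Import sesquilinear complex.
From mathcomp Require Import all_classical all_reals all_analysis.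
From mathcomp Require Import ring lra.
Import Order.TTheory GRing.Theory Num.Theory Num.Def.
Local Open Scope ring_scope.
Local Open Scope complex_scope.

(* K = T(k) is normal, so eigenvectors of K are eigenvectors of T(k^* ) and of
   the self-adjoint H = K T(k^* ).  The operators T(e) and T(f) multiply the
   positive eigenvalues of H by q^-2 and q^2, so they are nilpotent on an
   eigenvector, eigenvectors for distinct eigenvalues being orthogonal.  This
   gives w with T(e) w = 0 and K w = lam w, and a last nonzero T(f)^n w.
   Applying T(e) to T(f)^(n+1) w = 0 forces |lam|^2 = q^-n, which leaves only
   the phase of lam free.  The rescaled vectors T(f)^j w, j <= n, are then
   orthogonal, are acted upon as prescribed, and span V by irreducibility. *)

Set Implicit Arguments.
Unset Strict Implicit.
Unset Printing Implicit Defensive.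

(** * Ladders of eigenvectors *)

Lemma lfun_eigenvector (C : numClosedFieldType) (V : vectType C)
    (f : 'End(V)) : {:V}%VS != 0%VS ->
  exists a v, v != 0 /\ f v = a *: v.
Proof.
rewrite -dimv_eq0 -lt0n => dimV.
have [a /eigenvalueP[u ufE u0]] :=
  spectral.eigenvalue_closed (passmx.mxof (vbasis {:V}) (vbasis {:V}) f) dimV.
exists a, (passmx.vecof (vbasis {:V}) u); split.
  by rewrite passmx.vecof_eq0 ?basis_free ?vbasisP.
rewrite (passmx.hom_vecof _ (vbasisP _)) ufE.
exact: (GRing.scalable_linear (passmx.vecof_linear _)).
Qed.

(** Put [u = fs v - a^* v]. Since [f] and [fs] commute, [f u = a u]; moving [fs] across the form
    then gives [dot u u = a (dot u v) - a (dot u v) = 0]. *)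
Lemma normal_eigenvector (C : numClosedFieldType) (V : vectType C)
    (dot : {dot V for conjC}) (f fs : 'End(V)) (a : C) (v : V) :
    (forall x y, dot (f x) y = dot x (fs y)) ->
    (forall x, f (fs x) = fs (f x)) ->
  f v = a *: v -> fs v = (a^*) *: v.
Proof.
move=> adj ffs fv; apply/eqP; rewrite -subr_eq0 -(dnorm_eq0 dot).
set u := fs v - _; have fu : f u = a *: u.
  by rewrite /u linearB linearZ /= ffs fv linearZ /= scalerBr scalerA mulrC -scalerA.
rewrite {2}/u linearBr /= -adj fu linearZl_LR linearZr_LR /= conjCK.
by rewrite subrr.
Qed.

Lemma iter_eigenvector (F : fieldType) (V : vectType F) (f g : 'End(V))
    (r mu : F) (v : V) :
    (forall x, f (g x) = r *: g (f x)) -> f v = mu *: v ->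
  forall i, f (iter i g v) = (r ^+ i * mu) *: iter i g v.
Proof.
move=> fg fv; elim=> [|i IH] /=; first by rewrite mul1r.
by rewrite fg IH linearZ /= scalerA mulrA exprS.
Qed.

Section Ladder.
Variables (C : numClosedFieldType) (V : vectType C) (dot : {dot V for conjC}).
Variables (h g : 'End(V)) (r mu : C) (v : V).
Hypothesis hh : forall x y, dot (h x) y = dot x (h y).
Hypothesis hg : forall x, h (g x) = r *: g (h x).
Hypotheses (r_gt0 : 0 < r) (r_neq1 : r != 1).
Hypotheses (mu_gt0 : 0 < mu) (hv : h v = mu *: v).

(** The two vectors have [h]-eigenvalues [r ^+ i * mu] and [r ^+ j * mu]. These are real, so the
    symmetry of [h] applies, and distinct, because [r] is positive and not 1. *)
Lemma ladder_orthogonal (i j : nat) :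
  i != j -> dot (iter i g v) (iter j g v) = 0.
Proof.
move=> ij; have hE := iter_eigenvector hg hv.
have := hh (iter i g v) (iter j g v).
rewrite !hE linearZl_LR linearZr_LR /= geC0_conj; last first.
  by rewrite mulr_ge0 ?exprn_ge0 // ltW.
move/eqP; rewrite -subr_eq0 -mulrBl mulf_eq0 => /orP[|/eqP//].
rewrite -mulrBl mulf_eq0 (gt_eqF mu_gt0) orbF subr_eq0.
by move=> /eqP/(ieexprIn r_gt0 r_neq1)/eqP; rewrite (negPf ij).
Qed.

(** Otherwise the first [\dim {:V} + 1] rungs would be nonzero and pairwise orthogonal, hence
    linearly independent. *)
Lemma ladder_nilpotent : exists N, iter N g v = 0.
Proof.
apply: contrapT => /forallNP g_neq0.
pose S := [seq iter i g v | i <- iota 0 (\dim {:V}).+1].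
have S_free : free S.
  apply: (@orthogonal_free _ _ dot); apply/pairwise_orthogonalP; split.
    rewrite cons_uniq; apply/andP; split.
      by apply/mapP => -[i _ /esym]; exact: g_neq0.
    (* Two equal rungs with distinct indices would form a vector orthogonal to itself, hence
       zero. *)
    rewrite map_inj_uniq ?iota_uniq // => i j gij.
    have [//|/ladder_orthogonal/eqP] := eqVneq i j.
    by rewrite gij dnorm_eq0 => /eqP/g_neq0.
  move=> _ _ /mapP[i _ ->] /mapP[j _ ->] gij; apply: ladder_orthogonal.
  by apply: contraNneq gij => ->.
have := dimvS (subvf <<S>>); rewrite (eqP S_free) size_map size_iota.
by rewrite ltnn.
Qed.

End Ladder.

(* The telescoped coefficient c_j in T(e) T(f)^j w = c_j T(f)^(j-1) w, for w of
   lowest weight with K T(k^* ) w = mu w. *)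
Definition lowering_coef (F : fieldType) (Q mu : F) (j : nat) : F :=
  (Q ^+ j - Q ^- j) * (mu * Q ^+ j / Q - Q / (mu * Q ^+ j))
    / ((Q - Q^-1) * (Q^-1 - Q)).

(** The increment is the eigenvalue of [ef - fe] on [T(f)^j w], where [K T(k^* )] acts by
    [mu * Q ^+ (2 * j)]; [lowering_coef] is the closed form of the resulting geometric sums. *)
Lemma lowering_coefS (F : fieldType) (Q mu : F) (j : nat) :
    Q != 0 -> Q ^+ 2 != 1 -> mu != 0 ->
  lowering_coef Q mu j.+1 = lowering_coef Q mu j
    + (Q^-1 - Q)^-1 * (mu * Q ^+ (2 * j) - (mu * Q ^+ (2 * j))^-1).
Proof.
move=> Q0 Q1 mu0; rewrite /lowering_coef exprS mulnC exprM.
have Qj0 : Q ^+ j != 0 by rewrite expf_neq0.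
move: (Q ^+ j) Qj0 => a a0.
have D0 : Q * Q - 1 != 0 by rewrite subr_eq0 -expr2.
have D1 : 1 - Q * Q != 0 by rewrite subr_eq0 eq_sym -expr2.
by field; rewrite Q0 mu0 a0 D0 mulNr D1.
Qed.

Lemma lowering_iter (F : fieldType) (V : vectType F) (e f : 'End(V))
    (Q mu : F) (w : V) :
    Q != 0 -> Q ^+ 2 != 1 -> mu != 0 -> e w = 0 ->
    (forall i, e (f (iter i f w)) - f (e (iter i f w)) =
      ((Q^-1 - Q)^-1 * (mu * Q ^+ (2 * i) - (mu * Q ^+ (2 * i))^-1))
        *: iter i f w) ->
  forall j, e (iter j.+1 f w) = lowering_coef Q mu j.+1 *: iter j f w.
Proof.
move=> Q0 Q1 mu0 ew ef; elim=> [|j IH].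
  have /= := ef 0%N; rewrite ew linear0 subr0 => ->.
  by rewrite lowering_coefS // /lowering_coef expr0 invr1 subrr !mul0r add0r.
have /eqP := ef j.+1; rewrite subr_eq => /eqP; rewrite {1}/iter -/iter => ->.
by rewrite IH linearZ -scalerDl addrC -lowering_coefS.
Qed.

(** * Complex numbers of modulus one *)

Section Phases.
Variable R : realType.

Lemma expiD (s t : R) : expi (s + t) = expi s * expi t.
Proof.
by apply/eqP; rewrite /expi eq_complex /= sinD cosD eqxx addrC eqxx.
Qed.

Lemma expi0 : expi (0 : R) = 1.
Proof. by rewrite /expi sin0 cos0. Qed.

Lemma conj_expi (t : R) : ((expi t)^*)%R = expi (- t).
Proof. by apply/eqP; rewrite /expi eq_complex /= sinN cosN !eqxx. Qed.

Lemma expiX (t : R) (j : nat) : expi t ^+ j = expi (j%:R * t).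
Proof.
elim: j => [|j IH]; first by rewrite mul0r expi0.
by rewrite exprS IH -expiD -natr1 mulrDl mul1r addrC.
Qed.

Lemma unit_expi (z : R[i]) : z * (z^*)%R = 1 ->
  exists2 psi, 0 <= psi < 2 * pi & z = expi psi.
Proof.
case: z => a b /eqP; rewrite eq_complex /= => /andP[/eqP ab _].
have {}ab : a ^+ 2 + b ^+ 2 = 1 by rewrite -ab; ring.
have a1 : -1 <= a <= 1.
  rewrite -ler_norml -(@expr_le1 _ 2) // real_normK ?num_real //.
  by rewrite -ab lerDl sqr_ge0.
have sb : sin (acos a) = `|b|.
  by rewrite sin_acos // -ab addrAC subrr add0r sqrtr_sqr.
have pi0 := pi_gt0 R.
have [b0|b0] := leP 0 b.
  exists (acos a).
    by rewrite acos_ge0 //= (le_lt_trans (acos_lepi _)) // ltr_pMl ?ltr1n.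
  by rewrite /expi sb acosK ?ger0_norm // inE.
(* When [b < 0] the angle is [2 pi - acos a]. It stays strictly below [2 pi] only if [acos a > 0],
   that is [a < 1]; and [a = 1] would force [b = 0]. *)
have a_lt1 : a < 1.
  rewrite lt_neqAle; case/andP: (a1) => _ ->; rewrite andbT.
  apply/eqP => a_eq1; move: ab; rewrite a_eq1 expr1n => /eqP.
  by rewrite -subr_eq0 addrAC subrr add0r sqrf_eq0 lt_eqF.
exists (- acos a + pi *+ 2).
  have := acos_lepi a1.
  have : 0 < acos a by rewrite acos_gt0 // a_lt1; case/andP: a1 => ->.
  by rewrite mulr2n; lra.
rewrite /expi cosD2pi sinD2pi cosN sinN sb acosK ?inE //.
by rewrite ltr0_norm // opprK.
Qed.

End Phases.

(** * Representations of the algebra *)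

Section Representation.
Variables (R : realType) (q phi : R) (V : vectType R[i]).
Variable T : {linear Uqphi q phi -> 'End(V)}.
Hypothesis repT : is_rep T.
Implicit Types (s t : uterm R) (v : V).

Local Notation rho s v := (T (Upi q phi s) v).

Lemma rep_cong s t : ucong q phi s t -> forall v, rho s v = rho t v.
Proof. by move=> /UpiP st v; rewrite st. Qed.

Lemma repM s t v : rho (uMul s t) v = rho s (rho t v).
Proof.
rewrite -UmulE.
have [_ /(_ (Upi q phi s) (Upi q phi t))] := repT.
by rewrite /GRing.mul /= => ->; rewrite lfunE.
Qed.

Lemma repD s t v : rho (uAdd s t) v = rho s v + rho t v.
Proof.
rewrite -UaddE.
by have /= := linearD T (Upi q phi s) (Upi q phi t) => ->; rewrite lfunE.
Qed.

Lemma repC c v : rho (uC c) v = c *: v.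
Proof.
have [T1 _] := repT.
have cE : c *: (1 : Uqphi q phi) = Upi q phi (uMul (uC c) (uC 1)).
  exact: UscaleE.
have -> : rho (uC c) v = T (c *: 1) v.
  rewrite cE; congr (T _ v); apply/UpiP; rewrite -{1}[c]mulr1.
  exact: ucong_CM.
by rewrite linearZ T1 !lfunE /= lfunE.
Qed.

Local Notation "'E'" := (T (Upi q phi uE)).
Local Notation "'F'" := (T (Upi q phi (uStar uE))).
Local Notation "'K'" := (T (Upi q phi uK)).
Local Notation "'Ks'" := (T (Upi q phi (uStar uK))).

Lemma rep_EK v :
  E (K v) = (q%:C * expi (- (4 * phi))) *: K (E v).
Proof. by have := rep_cong (ucong_EK q phi) v; rewrite !repM repC. Qed.

Lemma rep_KF v :
  K (F v) = (q%:C * expi (- (4 * phi))) *: F (K v).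
Proof. by have := rep_cong (ucong_KF q phi) v; rewrite !repM repC. Qed.

Lemma rep_KsF v :
  Ks (F v) = (q%:C * expi (4 * phi)) *: F (Ks v).
Proof. by have := rep_cong (ucong_KsF q phi) v; rewrite !repM repC. Qed.

Lemma rep_EKs v :
  E (Ks v) = (q%:C * expi (4 * phi)) *: Ks (E v).
Proof. by have := rep_cong (ucong_EKs q phi) v; rewrite !repM repC. Qed.

Lemma rep_KKs v : K (Ks v) = Ks (K v).
Proof. by have := rep_cong (ucong_KKs q phi) v; rewrite !repM. Qed.

Lemma rep_Kinv (a : R[i]) v : a != 0 -> K v = a *: v ->
  T (Upi q phi uKinv) v = a^-1 *: v.
Proof.
move=> a0 Kv; have := rep_cong (ucong_VK q phi) v.
rewrite repM repC scale1r Kv linearZ /= => {2}<-.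
by rewrite scalerA mulVf // scale1r.
Qed.

Lemma rep_Ksinv (a : R[i]) v : a != 0 -> Ks v = a *: v ->
  T (Upi q phi (uStar uKinv)) v = a^-1 *: v.
Proof.
move=> a0 Ksv.
(* The left inverse of [k^*] comes from applying the star to [k k^-1 = 1], which reverses the
   product. *)
have VK : ucong q phi (uMul (uStar uKinv) (uStar uK)) (uC 1).
  apply: ucong_trans (ucong_sym (ucong_starM _ _ _ _)) _.
  apply: ucong_trans (ucong_star (ucong_KV q phi)) _.
  by have := ucong_starC q phi 1; rewrite rmorph1.
have := rep_cong VK v.
rewrite repM repC scale1r Ksv linearZ /= => {2}<-.
by rewrite scalerA mulVf // scale1r.
Qed.

Lemma rep_eigenvalue_neq0 (a : R[i]) v : v != 0 -> K v = a *: v -> a != 0.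
Proof.
move=> v0 Kv; apply: contraNneq v0 => a0.
have := rep_cong (ucong_VK q phi) v.
by rewrite repM repC scale1r Kv a0 scale0r linear0 => <-.
Qed.

(** On a common eigenvector of [k] and [k^*] the right-hand side of the commutation relation of [e]
    and [f] becomes a scalar depending only on [|a|^2]. *)
Lemma rep_EF (a : R[i]) v : a != 0 -> K v = a *: v -> Ks v = (a^*)%R *: v ->
  E (F v) - F (E v) =
  ((q%:C^-1 - q%:C)^-1 * (a * (a^*)%R - (a * (a^*)%R)^-1)) *: v.
Proof.
move=> a0 Kv Ksv; have := rep_cong (ucong_EF q phi) v.
have as0 : (a^*)%R != 0 by rewrite conjC_eq0.
rewrite !(repM, repD, repC) (rep_Ksinv as0 Ksv) Ksv !linearZ /= Kv.
rewrite (rep_Kinv a0 Kv) !scalerA scaleN1r => ->.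
rewrite -scalerDl scalerA fmorphV rmorphB fmorphV.
by rewrite mulrN1 mulNr -invfM [_ * a]mulrC.
Qed.

(** Irreducibility concerns subspaces stable under the whole algebra; this reduces the check to the
    generators and their inverses. *)
Lemma rep_stable (W : {vspace V}) :
    {in W, forall v, E v \in W} -> {in W, forall v, F v \in W} ->
    {in W, forall v, K v \in W} -> {in W, forall v, Ks v \in W} ->
    {in W, forall v, T (Upi q phi uKinv) v \in W} ->
    {in W, forall v, T (Upi q phi (uStar uKinv)) v \in W} ->
  forall x, (T x @: W <= W)%VS.
Proof.
move=> WE WF WK WKs WKi WKsi; elim/UpiW=> s; apply/subvP => _ /memv_imgP[v Wv ->].
(* Terms contain nested stars, so the claim for s and for its star must be
   proved together. *)
suff: {in W, forall v, rho s v \in W} /\ {in W, forall v, rho (uStar s) v \in W}.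
  by move=> [+ _]; apply.
elim: s {v Wv} =>
  [c||||s [IHs IHs'] t [IHt IHt']|s [IHs IHs'] t [IHt IHt']|s [IHs IHs']].
- split=> v Wv; first by rewrite repC memvZ.
  by rewrite (rep_cong (ucong_starC q phi c) v) repC memvZ.
- by [].
- by [].
- by [].
- split=> v Wv; first by rewrite repD memvD ?IHs ?IHt.
  by rewrite (rep_cong (ucong_starD q phi s t) v) repD memvD ?IHs' ?IHt'.
- split=> v Wv; first by rewrite repM IHs ?IHt.
  by rewrite (rep_cong (ucong_starM q phi s t) v) repM IHt' ?IHs'.
- split=> v Wv; first exact: IHs'.
  by rewrite (rep_cong (ucong_starK q phi s) v) IHs.
Qed.

End Representation.

(** * Lowering coefficients, quantum integers and weights *)

Lemma lowering_coef_eq0 (F : numFieldType) (Q mu : F) (n : nat) :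
    0 < Q -> Q != 1 -> 0 < mu ->
  lowering_coef Q mu n.+1 = 0 -> mu * Q ^+ n = 1.
Proof.
move=> Q0 Q1 mu0 /eqP.
have Qn0 : Q != 0 by rewrite gt_eqF.
have Q_inv k : Q ^+ k.+1 - Q ^- k.+1 != 0.
  rewrite subr_eq0; apply: contraNneq Q1 => QV.
  have : (Q ^+ k.+1) ^+ 2 = 1 by rewrite expr2 {2}QV divff // expf_neq0.
  by rewrite -exprM => /eqP; rewrite pexpr_eq1 // ltW.
have x0 : 0 < mu * Q ^+ n by rewrite mulr_gt0 // exprn_gt0.
have xE : mu * Q ^+ n.+1 / Q = mu * Q ^+ n by rewrite exprSr mulrA mulfK.
have xV : Q / (mu * Q ^+ n.+1) = (mu * Q ^+ n)^-1 by rewrite -xE invf_div.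
have D1 : Q - Q^-1 != 0 by have := Q_inv 0%N; rewrite expr1.
have D2 : Q^-1 - Q != 0 by rewrite -opprB oppr_eq0.
(* The only factor that can vanish is [x - x^-1] with [x = mu * Q ^+ n]. Then [x ^+ 2 = 1], and
   positivity leaves [x = 1]. *)
rewrite /lowering_coef xV xE !mulf_eq0 (negPf (Q_inv n)) /=.
rewrite invr_eq0 mulf_eq0 (negPf D1) (negPf D2) !orbF subr_eq0 => /eqP xx.
have /eqP : (mu * Q ^+ n) ^+ 2 = 1 by rewrite expr2 {2}xx divff // gt_eqF.
by rewrite pexpr_eq1 // ?(ltW x0) // => /eqP.
Qed.

(** For [mu = Q ^- n] the second factor is [Q^(j-n) - Q^(n-j)], and its sign is absorbed by
    [Q^-1 - Q]. The value is thus [[j+1]_Q [n-j]_Q], the square of the coefficient in [is_Tlpsi]. *)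
Lemma lowering_coef_qint (F : fieldType) (Q : F) (n j : nat) :
    Q != 0 -> Q ^+ 2 != 1 -> (j < n)%N ->
  lowering_coef Q (Q ^- n) j.+1 =
    (Q ^+ j.+1 - Q ^- j.+1) / (Q - Q^-1)
    * ((Q ^+ (n - j) - Q ^- (n - j)) / (Q - Q^-1)).
Proof.
move=> Q0 Q1 jn; rewrite /lowering_coef.
have -> : Q ^+ (n - j) = Q ^+ n / Q ^+ j.
  by rewrite -[in RHS](subnK (ltnW jn)) exprD mulfK // expf_neq0.
rewrite exprS.
have Qj0 : Q ^+ j != 0 by rewrite expf_neq0.
have Qn0 : Q ^+ n != 0 by rewrite expf_neq0.
move: (Q ^+ j) (Q ^+ n) Qj0 Qn0 => x y x0 y0.
have D0 : Q * Q - 1 != 0 by rewrite subr_eq0 -expr2.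
have D1 : 1 - Q * Q != 0 by rewrite subr_eq0 eq_sym -expr2.
by field; rewrite Q0 x0 y0 D0 mulNr D1.
Qed.

Section QuantumIntegers.
Variables (R : realType) (q : R).
Hypotheses (q_gt0 : 0 < q) (q_lt1 : q < 1).

Lemma qint0 : qint q 0 = 0.
Proof. by rewrite /qint oppr0 subrr mul0r. Qed.

Lemma qint_nat (j : nat) : qint q j%:Z = (q ^+ j - q ^- j) / (q - q^-1).
Proof. by rewrite /qint -exprnP exprnN. Qed.

Lemma qint_gt0 (j : nat) : (0 < j)%N -> 0 < qint q j%:Z.
Proof.
move=> j0; rewrite qint_nat.
(* For [0 < q < 1] both the numerator and the denominator of the quantum integer are negative. *)
have neg k : (0 < k)%N -> q ^+ k - q ^- k < 0.
  move=> k0; rewrite subr_lt0 (@lt_trans _ _ 1) ?exprn_ilt1 ?(ltW q_gt0) //.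
    by rewrite -lt0n.
  rewrite invf_gt1 ?exprn_gt0 // exprn_ilt1 ?(ltW q_gt0) //.
  by rewrite -lt0n.
rewrite nmulr_rgt0 ?neg // invr_lt0.
by have := neg 1%N isT; rewrite !expr1.
Qed.

End QuantumIntegers.

(** The hypothesis says [|lam| = q^(-n/2)], the modulus prescribed at the lowest weight [-n/2]. What
    remains of [lam] after dividing out the modulus and the factor [exp(2 i n phi)] is a pure phase
    [z], which must equal [exp(- i psi)]. *)
Lemma spin_phase (R : realType) (q phi : R) (n : nat) (lam : R[i]) :
    0 < q -> lam * (lam^*)%R * q%:C ^+ n = 1 ->
  exists2 psi, 0 <= psi < 2 * pi & forall j : nat,
    (q%:C * expi (- (4 * phi))) ^+ j * lam =
    (q `^ weight R n j)%:C * expi (- (4 * weight R n j * phi) - psi).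
Proof.
move=> q0 lamE.
have qn0 : q != 0 by rewrite gt_eqF.
pose h : R := n%:R / 2.
have hh : q `^ h * q `^ h = q ^+ n.
  by rewrite -powRD ?qn0 ?implybT // /h -splitr powR_mulrn // ltW.
pose z := lam * (q `^ h)%:C * expi (- (4 * h * phi)).
(* The polar form is applied to the conjugate of [z], because [k] carries the phase [- psi] while
   [psi] itself has to lie in [[0, 2 pi)]. *)
have zz : (z^*)%R * ((z^*)%R)^* %R = 1.
  rewrite conjCK /z !rmorphM /= conj_expi opprK.
  have -> : ((q `^ h)%:C^*)%R = (q `^ h)%:C by exact: conjc_real.
  rewrite -lamE -rmorphXn /= -hh rmorphM /=.
  have e1 : expi (4 * h * phi) * expi (- (4 * h * phi)) = 1.
    by rewrite -expiD subrr expi0.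
  set x := (q `^ h)%:C; set y := (lam^*)%R.
  transitivity (lam * y * (x * x) * (expi (4 * h * phi) * expi (- (4 * h * phi)))).
    by ring.
  by rewrite e1 mulr1.
have [psi psi_range zpsi] := unit_expi zz.
exists psi => // j.
have {zpsi} zpsi : z = expi (- psi) by rewrite -[z]conjCK zpsi conj_expi.
have wD : - (4 * weight R n j * phi) - psi =
    j%:R * (- (4 * phi)) + 4 * h * phi - psi.
  by rewrite /weight -/h; ring.
rewrite wD !expiD -zpsi /weight -/h powRD ?qn0 ?implybT // powR_mulrn ?ltW //.
rewrite exprMn expiX rmorphM rmorphXn /= /z.
have e1 : expi (4 * h * phi) * expi (- (4 * h * phi)) = 1.
  by rewrite -expiD subrr expi0.
have e2 : (q `^ (- h))%:C * (q `^ h)%:C = 1 :> R[i].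
  by rewrite -rmorphM /= -powRD ?qn0 ?implybT // addNr powRr0.
set a := expi (4 * h * phi) in e1 *; set b := expi (- (4 * h * phi)) in e1 *.
set c := (q `^ (- h))%:C in e2 *; set d := (q `^ h)%:C in e2 *.
set x := q%:C ^+ j; set y := expi _.
transitivity (x * y * lam * (a * b) * (c * d)); last by ring.
by rewrite e1 e2 !mulr1.
Qed.

(** * Lowest weight vectors and their ladders *)

Section LowestWeight.
Variables (R : realType) (q phi : R) (V : vectType R[i]) (dot : {dot V for conjC}).
Variable T : {linear Uqphi q phi -> 'End(V)}.
Hypotheses (q_gt0 : 0 < q) (q_lt1 : q < 1) (hT : is_star_rep dot T).

Local Notation p := (q%:C * expi (- (4 * phi))).
Local Notation "'E'" := (T (Upi q phi uE)).
Local Notation "'F'" := (T (Upi q phi (uStar uE))).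
Local Notation "'K'" := (T (Upi q phi uK)).
Local Notation "'Ks'" := (T (Upi q phi (uStar uK))).

Let repT : is_rep T := proj1 hT.

Lemma rep_adj s x y :
  dot (T (Upi q phi s) x) y = dot x (T (Upi q phi (uStar s)) y).
Proof. by rewrite (proj2 hT) UstarE. Qed.

Lemma rep_Ks_eigen (a : R[i]) v : K v = a *: v -> Ks v = (a^*)%R *: v.
Proof.
apply: (normal_eigenvector (dot := dot)); first exact: rep_adj.
exact: rep_KKs.
Qed.

Lemma scale_neq0 : p != 0 :> R[i].
Proof.
apply/eqP => p0; have : p * expi (4 * phi) = 0 by rewrite p0 mul0r.
rewrite -mulrA -expiD addNr expi0 mulr1 => /eqP.
by rewrite fmorph_eq0 (gt_eqF q_gt0).
Qed.

Lemma scale_mul_conj : p * (q%:C * expi (4 * phi)) = q%:C ^+ 2 :> R[i].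
Proof. by rewrite mulrACA -expiD addNr expi0 mulr1 expr2. Qed.

Let H := (K \o Ks)%VF.

Lemma H_sym x y : dot (H x) y = dot x (H y).
Proof.
rewrite /H !lfunE /= !rep_adj; congr (dot _ _).
by rewrite (rep_cong _ (ucong_starK q phi uK)).
Qed.

Lemma H_F x : H (F x) = (q%:C ^+ 2) *: F (H x).
Proof.
by rewrite /H !lfunE /= rep_KsF // linearZ /= rep_KF // scalerA mulrC scale_mul_conj.
Qed.

Lemma H_E x : H (E x) = (q%:C ^- 2) *: E (H x).
Proof.
rewrite /H !lfunE /= rep_EK // rep_EKs // [K (_ *: _)]linearZ /=.
rewrite !scalerA -mulrA scale_mul_conj.
by rewrite mulVf ?scale1r // expf_neq0 // fmorph_eq0 gt_eqF.
Qed.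

Lemma qC_gt0 : 0 < q%:C :> R[i].
Proof. by rewrite ltcR. Qed.

Lemma H_eigen (a : R[i]) v : K v = a *: v -> H v = (a * (a^*)%R) *: v.
Proof.
move=> Kv; rewrite /H lfunE /= (rep_Ks_eigen Kv) linearZ /= Kv.
by rewrite scalerA mulrC.
Qed.

Lemma qC2_neq1 : q%:C ^+ 2 != 1 :> R[i].
Proof.
rewrite -rmorphXn fmorph_eq1.
by rewrite lt_eqF // exprn_ilt1 // ltW.
Qed.

Lemma lowest_weight_vector : {:V}%VS != 0%VS ->
  exists lam w, [/\ w != 0, E w = 0 & K w = lam *: w].
Proof.
move=> V0; have [a [v [v0 Kv]]] := lfun_eigenvector K V0.
have a0 := rep_eigenvalue_neq0 repT v0 Kv.
have [N EN] : exists N, iter N E v = 0.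
  apply: (@ladder_nilpotent _ _ dot H E (q%:C ^- 2) (a * (a^*)%R)).
  - exact: H_sym.
  - exact: H_E.
  - by rewrite invr_gt0 exprn_gt0 // qC_gt0.
  - by rewrite invr_eq1 qC2_neq1.
  - by rewrite mul_conjC_gt0.
  - exact: H_eigen.
have exN : exists N, iter N E v == 0 by exists N; apply/eqP.
case: (ex_minnP exN) => -[|m] /eqP Em min_m.
  by move: v0; rewrite -[v]/(iter 0 E v) Em eqxx.
(* The last nonzero [E^m v] is killed by [E]. From [E K = p K E], each application of [E] multiplies
   the [K]-eigenvalue by [p^-1]. *)
exists (p^-1 ^+ m * a), (iter m E v); split => //.
  by apply/negP => /min_m; rewrite ltnn.
apply: (iter_eigenvector _ Kv) => x.
by rewrite rep_EK // scalerA mulVf ?scale1r // scale_neq0.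
Qed.

Lemma highest_weight_bound (lam : R[i]) w : w != 0 -> K w = lam *: w ->
  exists n, iter n.+1 F w = 0 /\ forall j, (j <= n)%N -> iter j F w != 0.
Proof.
move=> w0 Kw.
have lam0 := rep_eigenvalue_neq0 repT w0 Kw.
have [N FN] : exists N, iter N F w = 0.
  apply: (@ladder_nilpotent _ _ dot H F (q%:C ^+ 2) (lam * (lam^*)%R)).
  - exact: H_sym.
  - exact: H_F.
  - by rewrite exprn_gt0 // qC_gt0.
  - by rewrite qC2_neq1.
  - by rewrite mul_conjC_gt0.
  - exact: H_eigen.
have exN : exists N, iter N F w == 0 by exists N; apply/eqP.
case: (ex_minnP exN) => -[|n] /eqP Fn min_n.
  by move: w0; rewrite -[w]/(iter 0 F w) Fn eqxx.
exists n; split=> // j jn; apply/negP => /min_n.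
by rewrite ltnNge jn.
Qed.

Lemma ladder_dot (lam : R[i]) w i j : w != 0 -> K w = lam *: w -> i != j ->
  dot (iter i F w) (iter j F w) = 0.
Proof.
move=> w0 Kw.
have lam0 := rep_eigenvalue_neq0 repT w0 Kw.
apply: (@ladder_orthogonal _ _ dot H F (q%:C ^+ 2) (lam * (lam^*)%R)).
- exact: H_sym.
- exact: H_F.
- by rewrite exprn_gt0 // qC_gt0.
- by rewrite qC2_neq1.
- by rewrite mul_conjC_gt0.
- exact: H_eigen.
Qed.

Lemma ladder_K (lam : R[i]) w i : K w = lam *: w ->
  K (iter i F w) = (p ^+ i * lam) *: iter i F w.
Proof.
by move=> Kw; apply: (iter_eigenvector _ Kw) => x; rewrite rep_KF.
Qed.

Lemma ladder_E (lam : R[i]) w : w != 0 -> E w = 0 -> K w = lam *: w ->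
  forall j, E (iter j.+1 F w) =
    lowering_coef q%:C (lam * (lam^*)%R) j.+1 *: iter j F w.
Proof.
move=> w0 Ew Kw.
have lam0 := rep_eigenvalue_neq0 repT w0 Kw.
apply: lowering_iter => //.
- by rewrite gt_eqF // qC_gt0.
- exact: qC2_neq1.
- by rewrite mulf_neq0 // conjC_eq0.
move=> i; have Ki := ladder_K i Kw.
have pil0 : p ^+ i * lam != 0 by rewrite mulf_neq0 // expf_neq0 // scale_neq0.
rewrite (rep_EF repT pil0 Ki (rep_Ks_eigen Ki)).
(* In [|p^i lam|^2] the phases of [p] cancel, leaving [q^(2i) |lam|^2] as [lowering_iter]
   expects. *)
suff -> : p ^+ i * lam * ((p ^+ i * lam)^*)%R = lam * (lam^*)%R * q%:C ^+ (2 * i).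
  by [].
rewrite rmorphM rmorphXn rmorphM /= conj_expi opprK.
have -> : (q%:C^*)%R = q%:C :> R[i] by exact: conjc_real.
by rewrite mulrACA -exprMn scale_mul_conj -exprM mulrC.
Qed.

End LowestWeight.

(** * Transport to column vectors *)

Section LinearCombination.
Variables (R : realType) (V : vectType R[i]) (n : nat) (u : nat -> V).

Definition lincomb (x : 'cV[R[i]]_n.+1) : V := \sum_i x i 0 *: u i.

Fact lincomb_linear : linear lincomb.
Proof.
move=> a x y; rewrite /lincomb scaler_sumr -big_split /=.
by apply: eq_bigr => i _; rewrite !mxE scalerDl scalerA.
Qed.

HB.instance Definition _ :=
  GRing.isLinear.Build R[i] 'cV[R[i]]_n.+1 V *:%R lincomb lincomb_linear.

Lemma lincomb_wvec j : (j <= n)%N -> lincomb (wvec R n j) = u j.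
Proof.
move=> jn; rewrite /lincomb (bigD1 (Ordinal (jn : (j < n.+1)%N))) //=.
rewrite big1 ?addr0; first by rewrite mxE eqxx scale1r.
by move=> i /negPf ij; rewrite mxE -val_eqE /= in ij *; rewrite ij scale0r.
Qed.

Lemma limg_lincombP (A : 'End(V)) :
    (forall j, (j <= n)%N -> A (u j) \in limg (linfun lincomb)) ->
  {in limg (linfun lincomb), forall v, A v \in limg (linfun lincomb)}.
Proof.
move=> Au _ /memv_imgP[x _ ->]; rewrite lfunE /= linear_sum memv_suml // => i _.
by rewrite linearZ memvZ // Au // -ltnS.
Qed.

Lemma limg_lincomb j : (j <= n)%N -> u j \in limg (linfun lincomb).
Proof.
by move=> jn; rewrite -(lincomb_wvec jn) -[lincomb _]lfunE memv_img ?memvf.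
Qed.

(** Pairing a vanishing combination with [u i] isolates its [i]-th coordinate. *)
Lemma lker_lincomb (dot : {dot V for conjC}) :
    (forall j, (j <= n)%N -> u j != 0) ->
    (forall i j, i != j -> dot (u i) (u j) = 0) ->
  lker (linfun lincomb) == 0%VS.
Proof.
move=> u0 uu; apply/lker0P => x y; rewrite !lfunE /= => /eqP.
rewrite -subr_eq0 -linearB => /eqP; move: (x - y) (subr0_eq (x := x) (y := y)).
move=> z zxy z0; apply: zxy; apply/colP => i; rewrite mxE.
have : dot (lincomb z) (u i) = 0 by rewrite z0 linear0l.
rewrite /lincomb linear_sumlz (bigD1 i) //= big1 ?addr0; last first.
  by move=> j ji; rewrite linearZl_LR /= uu ?mulr0.
rewrite linearZl_LR /= => /eqP; rewrite mulf_eq0 dnorm_eq0.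
have /negPf -> : u i != 0 by rewrite u0 // -ltnS.
by rewrite orbF => /eqP.
Qed.

End LinearCombination.

Section Transport.
Variables (R : realType) (q phi : R) (V W : vectType R[i]).
Variables (T : {linear Uqphi q phi -> 'End(V)}) (g : 'Hom(W, V)).

(** [g^-1] is in general only a partial inverse. Linearity in [x] holds for any [g];
    multiplicativity and equivalence come with [lker g = 0] and [limg g = fullv]. *)
Definition transport (x : Uqphi q phi) : 'End(W) := (g^-1 \o T x \o g)%VF.

Fact transport_linear : linear transport.
Proof.
move=> a x y; rewrite /transport linearP comp_lfunDr comp_lfunDl.
by rewrite -comp_lfunZr -comp_lfunZl.
Qed.

HB.instance Definition _ :=
  GRing.isLinear.Build R[i] (Uqphi q phi) 'End(W) *:%R transport transport_linear.

Lemma transport_is_rep : lker g == 0%VS -> limg g = fullv ->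
  is_rep T -> is_rep transport.
Proof.
move=> kg ig [T1 TM]; split=> [|x y]; apply/lfunP => v.
  by rewrite /= /transport T1 !comp_lfunE !id_lfunE lker0_lfunK.
by rewrite /= /transport TM !comp_lfunE limg_lfunVK // ig memvf.
Qed.

Lemma transport_equivalent : lker g == 0%VS -> limg g = fullv ->
  equivalent_rep T transport.
Proof.
move=> kg ig; have gK v : g (g^-1%VF v) = v by rewrite limg_lfunVK // ig memvf.
exists g^-1%VF; split; first by exists g => // v; exact: lker0_lfunK.
by move=> x v; rewrite /= /transport !comp_lfunE gK.
Qed.

End Transport.

(** * Identification with the spin [n / 2] representation *)

Unset Implicit Arguments.

Theorem theorem4p2 (R : realType) (q phi : R)
    (hq : 0 <= q <= 1)
    (hq0 : q != 0) (hq1 : q != 1)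
    (hroot : forall r : nat, (0 < r)%N -> (q%:C * expi (- (4 * phi))) ^+ r != 1)
    (V : vectType R[i]) (dot : {dot V for conjC})
    (T : {linear Uqphi q phi -> 'End(V)})
    (hT : is_star_rep dot T) (hirr : irreducible_rep T)
    (b : bool) :
  exists (n : nat) (psi : R)
    (T' : {linear Uqphi q phi -> 'End('cV[R[i]]_n.+1)}),
    [/\ 0 <= psi < 2 * pi, is_rep T', is_Tlpsi psi b T' & equivalent_rep T T'].
Proof.
have q_gt0 : 0 < q by rewrite lt_def hq0; case/andP: hq.
have q_lt1 : q < 1 by rewrite lt_neqAle hq1; case/andP: hq.
have Q_gt0 : 0 < q%:C by exact: qC_gt0.
have [V0 irrT] := hirr.
have [lam [w [w0 Ew Kw]]] := lowest_weight_vector q_gt0 q_lt1 hT V0.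
have [n [Fw Fw0]] := highest_weight_bound q_gt0 q_lt1 hT w0 Kw.
set F := T (Upi q phi (uStar uE)) in Fw Fw0.
have Kj j := ladder_K hT j Kw.
have Ej := ladder_E q_gt0 q_lt1 hT w0 Ew Kw.
rewrite -/F in Kj Ej.
have lam0 := rep_eigenvalue_neq0 (proj1 hT) w0 Kw.
have lamE : lam * (lam^*)%R * q%:C ^+ n = 1.
  apply: lowering_coef_eq0 => //; first by rewrite fmorph_eq1.
    by rewrite mul_conjC_gt0.
  have /eqP := Ej n; rewrite Fw linear0 eq_sym scaler_eq0.
  by rewrite (negPf (Fw0 _ (leqnn n))) orbF => /eqP.
have [psi psi_range phase] := spin_phase phi q_gt0 lamE.
(* [c j] is the coefficient, sign included, required of [T(f)] on the [j]-th basis vector. It is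
   nonzero for [j < n] and vanishes at [j = n]. *)
pose c j : R := (-1) ^+ b * Num.sqrt (qint q (n%:Z - j%:Z) * qint q (j%:Z + 1)).
have c_neq0 j : (j < n)%N -> c j != 0.
  move=> jn; rewrite mulf_neq0 ?signr_eq0 // gt_eqF // sqrtr_gt0 mulr_gt0 //.
    by rewrite subzn ?(ltnW jn) // qint_gt0 // subn_gt0.
  by rewrite -PoszD qint_gt0 ?addn1.
have lowE j : (j < n)%N ->
    lowering_coef q%:C (lam * (lam^*)%R) j.+1 = (c j ^+ 2)%:C.
  move=> jn; have -> : lam * (lam^*)%R = q%:C ^- n.
    have Qn0 : q%:C ^+ n != 0 by rewrite expf_neq0 // gt_eqF.
    by apply: (mulIf Qn0); rewrite lamE mulVf.
  rewrite lowering_coef_qint ?qC2_neq1 ?(gt_eqF Q_gt0) //.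
  rewrite exprMn sqrr_sign mul1r sqr_sqrtr; last first.
    rewrite mulr_ge0 // -?PoszD ?subzn ?(ltnW jn) // ltW // qint_gt0 ?addn1 //.
    by rewrite subn_gt0.
  rewrite subzn ?(ltnW jn) // -PoszD !qint_nat addn1.
  by rewrite !(rmorphM, fmorphV, rmorphB, rmorphXn) /= mulrC.
(* The rescaling is chosen so that [d j = c j * d j.+1], which turns
   [F (iter j F w) = iter j.+1 F w] into [F (u j) = c j *: u j.+1]. *)
pose d j : R[i] := \prod_(i < j) (c i)%:C^-1.
have d_neq0 j : (j <= n)%N -> d j != 0.
  move=> jn; apply/prodf_neq0 => i _; rewrite invr_eq0 fmorph_eq0 c_neq0 //.
  exact: leq_trans (ltn_ord i) jn.
pose u j := d j *: iter j F w.
have u_neq0 j : (j <= n)%N -> u j != 0.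
  by move=> jn; rewrite scaler_eq0 negb_or d_neq0 // Fw0.
have uu i j : i != j -> dot (u i) (u j) = 0.
  move=> ij; rewrite linearZl_LR linearZr_LR /=.
  by rewrite (ladder_dot q_gt0 q_lt1 hT w0 Kw ij) !mulr0.
pose lamj j : R[i] := (q%:C * expi (- (4 * phi))) ^+ j * lam.
have lamj0 j : lamj j != 0 by rewrite mulf_neq0 // expf_neq0 // scale_neq0.
have uK j : T (Upi q phi uK) (u j) = lamj j *: u j.
  by rewrite linearZ /= Kj scalerA mulrC -scalerA.
have uKs j := rep_Ks_eigen hT (uK j).
have cn : c n = 0 by rewrite /c subrr qint0 mul0r sqrtr0 mulr0.
have uF j : (j <= n)%N -> F (u j) = (c j)%:C *: u j.+1.
  rewrite leq_eqVlt => /orP[/eqP->|jn].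
    by rewrite cn scale0r linearZ /= -[F _]/(iter n.+1 F w) Fw scaler0.
  rewrite linearZ /u /d big_ord_recr /= scalerA mulrCA mulfV ?mulr1 //.
  by rewrite fmorph_eq0 c_neq0.
have uE0 : T (Upi q phi uE) (u 0%N) = 0 by rewrite linearZ /= Ew scaler0.
(* Lowering [T(f)^(j+1) w] produces [c j ^+ 2]; the rescaling absorbs one factor, so [e] and [f]
   share the coefficient [c j] and hence the sign. *)
have uES j : (j < n)%N -> T (Upi q phi uE) (u j.+1) = (c j)%:C *: u j.
  move=> jn; have := Ej j; rewrite lowE // => Ejn.
  rewrite linearZ [T _]lock /= -lock Ejn /u /d big_ord_recr /= !scalerA.
  rewrite rmorphXn /= expr2; congr (_ *: _).
  by rewrite mulrA mulfVK ?fmorph_eq0 ?c_neq0 // mulrC.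
pose g := linfun (@lincomb _ _ n u).
have kg : lker g == 0%VS by exact: lker_lincomb uu.
have g_wvec j : (j <= n)%N -> g (wvec R n j) = u j.
  by move=> jn; rewrite lfunE /= lincomb_wvec.
(* The span of the [u j] is stable under the generators and contains [u 0], which is nonzero, so
   irreducibility makes it all of [V]. *)
have ig : limg g = fullv.
  have memu j : (j <= n)%N -> u j \in limg g by exact: limg_lincomb.
  have [] // := irrT (limg g); last first.
    move=> g0; have := memu 0%N isT.
    by rewrite g0 memv0 (negPf (u_neq0 _ _)).
  apply: (rep_stable (proj1 hT)); apply: limg_lincombP => j jn.
  - case: j jn => [|j] jn; first by rewrite uE0 mem0v.
    by rewrite uES // memvZ // memu // ltnW.
  - move: jn (uF _ jn) => + ->; rewrite leq_eqVlt => /orP[/eqP->|jn].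
      by rewrite cn scale0r mem0v.
    by rewrite memvZ // memu.
  - by rewrite uK memvZ // memu.
  - by rewrite uKs memvZ // memu.
  - by rewrite (rep_Kinv (proj1 hT) (lamj0 j) (uK j)) memvZ // memu.
  - rewrite (rep_Ksinv (proj1 hT) _ (uKs j)) ?conjC_eq0 //.
    by rewrite memvZ // memu.
have gV j : (j <= n)%N -> (g^-1)%VF (u j) = wvec R n j.
  by move=> jn; rewrite -g_wvec // lker0_lfunK.
have TgE x j : (j <= n)%N ->
    transport T g x (wvec R n j) = (g^-1)%VF (T x (u j)).
  by move=> jn; rewrite /transport !comp_lfunE g_wvec.
exists n, psi, (transport T g); split=> //.
- by apply: transport_is_rep => //; exact: proj1 hT.
- move=> j jn m; rewrite !TgE // !UstarE -/F; split.
  + by rewrite uK linearZ /= gV // /lamj phase.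
  + rewrite uKs linearZ /= gV // /lamj phase rmorphM /= conj_expi opprB opprK addrC.
    by congr (_ *: _); congr (_ * _); exact: conjc_real.
  (* At [j = n] the vector [u n.+1] has no matching basis vector, but [[0]_q = 0] annihilates both
     sides. *)
  + rewrite uF // linearZ /=; move: jn; rewrite leq_eqVlt => /orP[/eqP jn|jn].
      by rewrite /c jn subrr qint0 mul0r sqrtr0 mulr0 !scale0r.
    by rewrite gV.
  (* At [j = 0] both sides vanish, again by [[0]_q = 0]. At [j.+1] the prescribed product is that of
     [c j] with its two factors exchanged. *)
  + case: j jn @m => [|j] jn m.
      by rewrite uE0 linear0 qint0 mul0r sqrtr0 mulr0 scale0r.
    rewrite uES // linearZ /= gV ?(ltnW jn) //.
    congr (_%:C *: _); congr (_ * Num.sqrt _).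
    rewrite mulrC; congr (qint q _ * qint q _); first by rewrite -PoszD addn1.
    by rewrite -addn1 PoszD; ring.
- exact: transport_equivalent.
Qed.
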